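(* Let $Y$ be any continuous real random variable, represented (almost surely) by the infinite simple continued fraction $Y=[A_0;A_1,A_2,\dots]$, let $F_{\{Y\}}$ be the cumulative distribution function of the fractional part $\{Y\}$, and let $\mathbf{A}_k=[A_1,\ldots,A_k]$ for an integer $k\ge 1$. Then for every $\mathbf{a}_k=[a_1,\ldots,a_k]\in\mathbb{N}^k$, $$\Pr(\mathbf{A}_k=\mathbf{a}_k)=(-1)^k\Big(F_{\{Y\}}\big([0;\mathbf{a}_k+\mathbf{e}_k]\big)-F_{\{Y\}}\big([0;\mathbf{a}_k]\big)\Big).$$
   Context: $\mathbb{N}$ excludes zero. A continuous random variable is one that has a probability density function. $\{z\}=z-\lfloor z\rfloor$ is the fractional part and $F_Z(z)=\Pr(Z\le z)$. The continued fraction coefficients of $Y$ are defined by $Y_0=Y$, $Y_j=\{Y_{j-1}\}^{-1}$ for $j\ge 1$, and $A_j=\lfloor Y_j\rfloor$; since $\Pr(Y\in\mathbb{Q})=0$, all of these are almost surely well defined, with $A_j\in\mathbb{N}$ for $j\ge 1$. $\mathbf{e}_k=[0,\ldots,0,1]$ is the $k$-vector with a one in position $k$ and zeros elsewhere. $[0;\mathbf{a}_k]=[0;a_1,\ldots,a_k]$ denotes the finite simple continued fraction $\cfrac{1}{a_1+\cfrac{1}{a_2+\cdots+\cfrac{1}{a_k}}}$, and so $[0;\mathbf{a}_k+\mathbf{e}_k]=[0;a_1,\ldots,a_{k-1},a_k+1]$. *)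

(* Defs.v *)
From HB Require Import structures.
From mathcomp Require Import all_boot all_order all_algebra.
From mathcomp Require Import all_classical all_reals all_analysis.
From mathcomp Require Import measurable_realfun.

Set Implicit Arguments.
Unset Strict Implicit.
Unset Printing Implicit Defensive.

Import Order.TTheory GRing.Theory Num.Theory.
Import numFieldNormedType.Exports.

Local Open Scope classical_set_scope.
Local Open Scope ring_scope.

Definition is_density (d : measure_display) (T : measurableType d)
    (R : realType) (P : probability T R) (X : {RV P >-> R}) (f : R -> R) : Prop :=
  [/\ measurable_fun setT f,
      (forall x : R, 0 <= f x) &
      forall B : set R, measurable B ->
        distribution P X B = (\int[lebesgue_measure]_(x in B) (f x)%:E)%E].

Definition continuous_RV (d : measure_display) (T : measurableType d)
    (R : realType) (P : probability T R) (X : {RV P >-> R}) : Prop :=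
  exists f : R -> R, is_density X f.

Definition fracpart (R : realType) (x : R) : R := x - (Num.floor x)%:~R.

Lemma measurable_fracpart (R : realType) : measurable_fun setT (@fracpart R).
Proof.
apply: measurable_funB => //; apply: nondecreasing_measurable => // x y xy.
by rewrite ler_int; exact: le_floor.
Qed.

HB.instance Definition _ (R : realType) :=
  isMeasurableFun.Build _ _ R R (@fracpart R) (@measurable_fracpart R).

Definition fracpart_RV (d : measure_display) (T : measurableType d)
    (R : realType) (P : probability T R) (X : {RV P >-> R}) : {RV P >-> R} :=
  @fracpart R \o X.

(* If {Y_(j-1)} = 0, which only happens for rational Y_0, the convention
   0^-1 = 0 makes all the remaining coefficients 0. *)
Definition cf_remainder (R : realType) (y : R) (j : nat) : R :=
  iter j (fun x : R => (fracpart x)^-1) y.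

Definition cf_coef (R : realType) (y : R) (j : nat) : int :=
  Num.floor (cf_remainder y j).

(* The vector [A_1, ..., A_k]: column i : 'I_k holds A_(i+1). *)
Definition cf_coefs (R : realType) (k : nat) (y : R) : 'rV[int]_k :=
  \row_(i < k) cf_coef y i.+1.

(* The value of [0; a_1, ..., a_k], with a_(i+1) = a 0 i. *)
Definition cf_value (R : realType) (k : nat) (a : 'rV[nat]_k) : R :=
  foldr (fun (m : nat) (x : R) => (m%:R + x)^-1) 0 [seq a 0 i | i <- enum 'I_k].

(* The vector [0, ..., 0, 1]. *)
Definition last_unit (k : nat) : 'rV[nat]_k :=
  \row_(i < k) (i.+1 == k : nat).

(* Main.v *)
Require Import Defs.
From HB Require Import structures.
From mathcomp Require Import all_boot all_order all_algebra.
From mathcomp Require Import all_classical all_reals all_analysis.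
From mathcomp Require Import measurable_realfun lra.

Import Order.TTheory GRing.Theory Num.Theory.
Import numFieldNormedType.Exports.
Local Open Scope classical_set_scope.
Local Open Scope ring_scope.

(** Fixing the first k coefficients of Y confines the fractional part of Y to a
    cylinder, which up to its ends is the image of the open unit interval under
    x |-> 1 / (a_1 + 1 / (... + 1 / (a_k + x))).  Each step x |-> 1 / (a + x)
    reverses the order, so the cylinder is an interval, with ends the values of
    this map at 0, which is [0; a_1, ..., a_k], and at 1, which is
    [0; a_1, ..., a_k + 1].  The value at 0 is the lower end exactly when k is
    even: this is where the sign (-1)^k comes from (lemmas [itv_oo_has_cf_coefs]
    and [has_cf_coefs_itv_cc]).

    Which ends belong to the cylinder depends on the parity of k and on whether
    a_k = 1, but it does not matter: the law of the fractional part has no atoms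
    ([fracpart_RV_atomless]), because a given real is the fractional part of
    countably many reals only and a law with a density does not charge countable
    sets.  Hence every set squeezed between an open interval and its closure has
    as probability the increment of the distribution function
    ([prob_squeezed_itv]). *)

(** * Continued fraction cylinders *)

Lemma fracpart_itv (R : realType) (y : R) : 0 <= fracpart y < 1.
Proof.
have /andP[h1 h2] := floor_itv y; rewrite /fracpart subr_ge0 h1 /=.
by rewrite intrD in h2; rewrite ltrBlDl.
Qed.

Lemma fracpart_id (R : realType) (u : R) : 0 <= u < 1 -> fracpart u = u.
Proof. by move=> h; rewrite /fracpart (@floor_def _ u 0) ?subr0. Qed.

(** The finite continued fraction whose last denominator [a_k] is perturbed to
    [a_k + x]. *)
Definition cf_tail (R : realType) (s : seq nat) (x : R) : R :=
  foldr (fun (m : nat) (z : R) => (m%:R + z)^-1) x s.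

(** Reading the parity of the length as the real number [0] or [1] puts the two
    ends of the cylinder in increasing order. *)
Definition cyl_lo (R : realType) (s : seq nat) : R :=
  cf_tail R s (odd (size s))%:R.

Definition cyl_hi (R : realType) (s : seq nat) : R :=
  cf_tail R s (~~ odd (size s))%:R.

Definition has_cf_coefs (R : realType) (y : R) (s : seq nat) : Prop :=
  forall i, (i < size s)%N -> cf_coef y i.+1 = Posz (nth 0%N s i).

Lemma cyl_lo_cons (R : realType) (m : nat) (s : seq nat) :
  cyl_lo R (m :: s) = (m%:R + cyl_hi R s)^-1.
Proof. by []. Qed.

Lemma cyl_hi_cons (R : realType) (m : nat) (s : seq nat) :
  cyl_hi R (m :: s) = (m%:R + cyl_lo R s)^-1.
Proof. by rewrite /cyl_hi /= negbK. Qed.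

Lemma cf_coefS (R : realType) (y : R) (j : nat) :
  cf_coef y j.+1 = cf_coef (fracpart y)^-1 j.
Proof. by rewrite /cf_coef /cf_remainder iterSr. Qed.

Lemma has_cf_coefs_cons (R : realType) (y : R) (m : nat) (s : seq nat) :
  has_cf_coefs R y (m :: s) <->
  Num.floor (fracpart y)^-1 = Posz m /\ has_cf_coefs R (fracpart y)^-1 s.
Proof.
split=> [h|[h0 h]].
  split; first exact: (h 0%N).
  by move=> i si; rewrite -cf_coefS; exact: (h i.+1).
by case=> [|i] si; rewrite cf_coefS; [exact: h0|exact: h].
Qed.

(** The successive remainders only see the fractional part. *)
Lemma has_cf_coefs_fracpart (R : realType) (y : R) (s : seq nat) :
  has_cf_coefs R (fracpart y) s <-> has_cf_coefs R y s.
Proof.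
have e := fracpart_id _ _ (fracpart_itv R y).
by split=> h i si; move: (h i si); rewrite !cf_coefS e.
Qed.

Lemma cyl_bounds (R : realType) (s : seq nat) :
  all (leq 1) s -> 0 <= cyl_lo R s < cyl_hi R s /\ cyl_hi R s <= 1.
Proof.
elim: s => [_|m s IH /= /andP[m1 /IH[/andP[l0 lh] h1]]].
  by rewrite /cyl_lo /cyl_hi /= lexx ltr01.
have m1R : (1 : R) <= m%:R by rewrite (ler_nat _ 1).
rewrite cyl_lo_cons cyl_hi_cons invr_ge0; split; last first.
  by rewrite invf_le1; lra.
by rewrite ltf_pV2 ?posrE; lra.
Qed.

(** Inverting [lo < {y} < hi] gives bounds on the next remainder [1 / {y}] that
    pin its floor to the head of the word and place its fractional part in the
    cylinder of the tail. *)
Lemma itv_oo_has_cf_coefs (R : realType) (s : seq nat) (y : R) :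
  all (leq 1) s -> cyl_lo R s < fracpart y < cyl_hi R s -> has_cf_coefs R y s.
Proof.
elim: s y => [//|m s IH] y /= /andP[m1 s1].
have [/andP[l0 lh] h1] := cyl_bounds R s s1.
have m1R : (1 : R) <= m%:R by rewrite (ler_nat _ 1).
rewrite cyl_lo_cons cyl_hi_cons => /andP[h2 h3].
have u0 : 0 < fracpart y by apply: lt_trans h2; rewrite invr_gt0; lra.
set z := (fracpart y)^-1.
have z0 : 0 < z by rewrite invr_gt0.
have zh : z < m%:R + cyl_hi R s.
  by rewrite -ltf_pV2 ?posrE ?invrK //; lra.
have zl : m%:R + cyl_lo R s < z.
  by rewrite -ltf_pV2 ?posrE ?invrK //; lra.
have fz : Num.floor z = Posz m.
  by apply: floor_def; rewrite intrD -pmulrn; lra.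
apply/has_cf_coefs_cons; split=> //; apply: IH => //.
by rewrite /fracpart -/z fz -pmulrn; lra.
Qed.

Lemma has_cf_coefs_itv_cc (R : realType) (s : seq nat) (y : R) :
  all (leq 1) s -> has_cf_coefs R y s -> cyl_lo R s <= fracpart y <= cyl_hi R s.
Proof.
elim: s y => [|m s IH] y /=.
  by rewrite /cyl_lo /cyl_hi /=; have := fracpart_itv R y; lra.
move=> /andP[m1 s1] /has_cf_coefs_cons[fz /(IH _ s1)].
have [/andP[l0 lh] h1] := cyl_bounds R s s1.
have m1R : (1 : R) <= m%:R by rewrite (ler_nat _ 1).
rewrite cyl_lo_cons cyl_hi_cons -[fracpart y in X in _ -> X]invrK.
move: fz; set z := (fracpart y)^-1 => fz.
rewrite /fracpart fz -pmulrn => hz.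
by rewrite !lef_pV2 ?posrE; lra.
Qed.

Lemma cylinder_squeezed (R : realType) (s : seq nat) :
  all (leq 1) s ->
  let D := [set u : R | 0 <= u < 1 /\ has_cf_coefs R u s] in
  `]cyl_lo R s, cyl_hi R s[ `<=` D /\ D `<=` `[cyl_lo R s, cyl_hi R s].
Proof.
move=> s1; have [/andP[l0 lh] h1] := cyl_bounds R s s1.
split=> u /=; rewrite in_itv /=.
  move=> hu; have u01 : 0 <= u < 1 by lra.
  by split=> //; apply: itv_oo_has_cf_coefs => //; rewrite fracpart_id.
by move=> [u01 /(has_cf_coefs_itv_cc _ _ _ s1)]; rewrite fracpart_id.
Qed.

(** * Words and row vectors *)

Definition row_word (k : nat) (a : 'rV[nat]_k) : seq nat :=
  [seq a 0 i | i <- enum 'I_k].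

Lemma size_row_word (k : nat) (a : 'rV[nat]_k) : size (row_word k a) = k.
Proof. by rewrite size_map size_enum_ord. Qed.

Lemma nth_row_word (k : nat) (a : 'rV[nat]_k) (i : 'I_k) :
  nth 0%N (row_word k a) i = a 0 i.
Proof. by rewrite (nth_map i) ?size_enum_ord // nth_ord_enum. Qed.

Lemma cf_coefsE (R : realType) (k : nat) (y : R) (a : 'rV[nat]_k) :
  cf_coefs k y = map_mx Posz a <-> has_cf_coefs R y (row_word k a).
Proof.
split=> [/rowP h i|h].
  rewrite size_row_word => ik; have := h (Ordinal ik).
  by rewrite !mxE => ->; rewrite -nth_row_word.
apply/rowP => i; rewrite !mxE h ?size_row_word //.
by rewrite nth_row_word.
Qed.

Lemma cf_value_tail0 (R : realType) (k : nat) (a : 'rV[nat]_k) :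
  cf_value R a = cf_tail R (row_word k a) 0.
Proof. by []. Qed.

(** This recognises the other end of the cylinder, at [x = 1], as the value of
    the word whose last partial quotient is increased by one. *)
Lemma cf_value_tail1 (R : realType) (k : nat) (a : 'rV[nat]_k) :
  (1 <= k)%N -> cf_value R (a + last_unit k) = cf_tail R (row_word k a) 1.
Proof.
case: k a => [//|n] a _.
rewrite /cf_value /cf_tail /row_word enum_ordSr !map_rcons !foldr_rcons.
rewrite -!map_comp !mxE /= eqxx addr0 natrD; congr (foldr _ _ _).
apply: eq_map => i /=; rewrite !mxE /= eqSS.
by rewrite (ltn_eqF (ltn_ord i)) addr0.
Qed.

(** * Laws without atoms *)

Lemma density_countable0 (d : measure_display) (T : measurableType d)
    (R : realType) (P : probability T R) (Y : {RV P >-> R}) (A : set R) :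
  continuous_RV Y -> countable A -> distribution P Y A = 0%E.
Proof.
move=> [f [mf f0 h]] cA.
have mA : measurable A by apply: countable_measurable.
rewrite h //; apply: null_set_integral => //.
  by apply/measurable_EFinP; exact: measurable_funS mf.
exact: countable_lebesgue_measure0.
Qed.

(** The reals with a given fractional part lie in a translate of the integers. *)
Lemma fracpart_RV_atomless (d : measure_display) (T : measurableType d)
    (R : realType) (P : probability T R) (Y : {RV P >-> R}) (c : R) :
  continuous_RV Y -> distribution P (fracpart_RV Y) [set c] = 0%E.
Proof.
move=> hY; apply: (density_countable0 _ _ _ _ Y (@fracpart R @^-1` [set c])) => //.
apply: (@sub_countable _ _ _ (range (fun z : int => c + z%:~R))).
  apply: subset_card_le => y /= <-; exists (Num.floor y) => //.
  by rewrite /fracpart subrK.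
by apply: sub_countable (card_image_le _ _) _; exact: countableP.
Qed.

(** The two inclusions force [D] to be an interval, hence measurable; it then
    differs from the half-open interval, whose probability is the increment of
    the distribution function, by at most the two null end points. *)
Lemma prob_squeezed_itv (R : realType)
    (Q : probability R R) (lo hi : R) (D : set R) :
  (forall c, Q [set c] = 0%E) -> lo <= hi ->
  `]lo, hi[ `<=` D -> D `<=` `[lo, hi] ->
  Q D = (Q `]-oo, hi]%classic - Q `]-oo, lo]%classic)%E.
Proof.
move=> Q0 lh oD Dc.
have mD : measurable D.
  apply: is_interval_measurable => x y Dx Dy z /andP[xz zy].
  have [<-//|xz'] := eqVneq x z; have [->//|zy'] := eqVneq z y.
  move: (Dc _ Dx) (Dc _ Dy); rewrite /= !in_itv /= => /andP[lx _] /andP[_ yh].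
  apply: oD; rewrite /= in_itv /=.
  rewrite (le_lt_trans lx) ?lt_neqAle ?xz' //=.
  by rewrite (le_trans zy yh) andbT; apply: contra_neq zy' => zh; lra.
have mo : measurable `]lo, hi[%classic by [].
have -> : (Q `]-oo, hi]%classic - Q `]-oo, lo]%classic)%E = Q `]lo, hi]%classic.
  rewrite (_ : `]lo, hi]%classic = `]-oo, hi] `\` `]-oo, lo]); last first.
    apply/seteqP; split=> x; rewrite /= !in_itv /=.
      by move=> /andP[lx ->]; split=> //; apply/negP; rewrite -ltNge.
    by move=> [-> /negP]; rewrite -ltNge => ->.
  rewrite measureD //; last by rewrite (le_lt_trans (probability_le1 _ _)) ?ltry.
  congr (_ - Q _)%E; apply/seteqP; split=> x; rewrite /= !in_itv /=.
    by move=> xl; split=> //; exact: le_trans lh.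
  by case.
apply/eqP; rewrite eq_le; apply/andP; split.
  rewrite (@le_trans _ _ (Q (`]lo, hi]%classic `|` [set lo]))) //; last first.
    by rewrite measureU0 //; exact: Q0.
  apply: le_measure; rewrite ?inE //; first exact: measurableU.
  move=> x /Dc; rewrite /= !in_itv /= le_eqVlt => /andP[/orP[/eqP<-|->] ->] //.
    by right.
  by left.
rewrite (@le_trans _ _ (Q (D `|` [set hi]))) //; last first.
  by rewrite measureU0 //; exact: Q0.
apply: le_measure; rewrite ?inE //; first exact: measurableU.
move=> x; rewrite /= in_itv /= [x <= hi]le_eqVlt => /andP[lx /orP[/eqP->|xh]].
  by right.
by left; apply: oD; rewrite /= in_itv /= lx.
Qed.

Theorem theorem3p2 (d : measure_display) (T : measurableType d) (R : realType)
    (P : probability T R) (Y : {RV P >-> R}) (hY : continuous_RV Y)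
    (k : nat) (hk : (1 <= k)%N)
    (a : 'rV[nat]_k) (ha : forall i : 'I_k, (1 <= a ord0 i)%N) :
  P [set w : T | cf_coefs k (Y w) = map_mx Posz a] =
  (((-1) ^+ k)%:E *
    (cdf (fracpart_RV Y) (cf_value R (a + last_unit k)) -
     cdf (fracpart_RV Y) (cf_value R a)))%E.
Proof.
set s := row_word k a.
have s1 : all (leq 1) s by apply/allP => m /mapP[i _ ->]; exact: ha.
have [/andP[_ lh] _] := cyl_bounds R s s1.
have [oD Dc] := cylinder_squeezed R s s1.
set D := [set u : R | _] in oD Dc.
have -> : [set w | cf_coefs k (Y w) = map_mx Posz a] = fracpart_RV Y @^-1` D.
  apply/seteqP; split=> w /=.
    move=> /cf_coefsE h; split; first exact: fracpart_itv.
    exact/has_cf_coefs_fracpart.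
  by move=> [_ /has_cf_coefs_fracpart h]; apply/cf_coefsE.
transitivity (cdf (fracpart_RV Y) (cyl_hi R s) -
              cdf (fracpart_RV Y) (cyl_lo R s))%E.
  apply: (prob_squeezed_itv R
    [the probability R R of distribution P (fracpart_RV Y)]) (ltW lh) oD Dc.
  by move=> c; exact: fracpart_RV_atomless.
rewrite cf_value_tail1 // cf_value_tail0 /cyl_hi /cyl_lo -/s size_row_word.
rewrite -signr_odd; case: (odd k) => /=; last by rewrite expr0 mul1e.
have cdf_fin x : cdf (fracpart_RV Y) x \is a fin_num by exact: fin_num_measure.
(* For odd [k] the sign swaps the two terms of the difference. *)
move: (cdf_fin (cf_tail R s 0)) (cdf_fin (cf_tail R s 1)).
case: (cdf _ _) => // p _; case: (cdf _ _) => // q _.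
by rewrite expr1 -!EFinB -EFinM mulN1r opprB.
Qed.
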